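(* Let $K$ be a field, let $G$ be a finite simple graph with no isolated vertices and let $k$ be an integer with $1\leq k\leq \nu(G)$ such that $I(G)^{[k]}$ has linear quotients. If $g_{I(G)}(k)=0$, then $G$ has a dominating $k$-matching. In particular, the statement holds for any cochordal graph $G$ with no isolated vertices: if $1\le k\le\nu(G)$ and $g_{I(G)}(k)=0$, then $G$ has a dominating $k$-matching.
   Context: Let $G$ have vertex set $V(G)=\{1,\ldots,n\}$ and let $S=K[x_1,\ldots,x_n]$. The edge ideal $I(G)\subset S$ is generated by all $x_ix_j$ with $\{i,j\}$ an edge of $G$. A $k$-matching $M$ is a set of $k$ pairwise disjoint edges; $V(M)$ is the set of vertices contained in edges of $M$; $\nu(G)$ is the maximum size of a matching. $M$ is a dominating $k$-matching if every vertex in $V(G)\setminus V(M)$ is adjacent to some vertex in $V(M)$. The $k$-th squarefree power $I(G)^{[k]}$ is the ideal generated by the squarefree monomials $x_{i_1}x_{j_1}\cdots x_{i_k}x_{j_k}$ where $\{i_1,j_1\},\ldots,\{i_k,j_k\}$ is a $k$-matching of $G$. For $1\le k\le \nu(G)$, $g_{I(G)}(k)=\operatorname{depth}(S/I(G)^{[k]})-(2k-1)$. A monomial ideal has linear quotients if its minimal monomial generators can be ordered $u_1,\ldots,u_s$ so that for all $i=2,\ldots,s$ the colon ideal $(u_1,\ldots,u_{i-1}):u_i$ is generated by variables. A graph is cochordal if its complementary graph is chordal (has no induced cycle of length greater than $3$). *)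

(* Defs.v *)
From HB Require Import structures.
From mathcomp Require Import all_boot all_order all_algebra.
From mathcomp Require Import mpoly.
From mathcomp Require boolp classical_sets.

Set Implicit Arguments.
Unset Strict Implicit.
Unset Printing Implicit Defensive.

Import GRing.Theory.
Local Open Scope ring_scope.

Section Graphs.
Variable n : nat.

Record sgraph := SGraph {
  adj :> rel 'I_n;
  adj_sym : ssrbool.symmetric adj;
  adj_irr : irreflexive adj
}.

Implicit Types (G : sgraph) (M : {set {set 'I_n}}).

Definition no_isolated_vertex G := forall i, exists j, G i j.

Definition edges G : {set {set 'I_n}} :=
  [set f | [exists i, exists j, G i j && (f == [set i; j])]].

Definition is_matching G M := (M \subset edges G) && trivIset M.

Definition is_kmatching G k M := is_matching G M && (#|M| == k).

Definition matching_number G := (\max_(M | is_matching G M) #|M|)%N.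

(* The vertex set V(M) is [cover M]. *)
Definition is_dominating_kmatching G k M :=
  is_kmatching G k M /\
  forall v, v \notin cover M -> exists2 u, u \in cover M & G v u.

Definition compl_rel G : rel 'I_n := [rel i j | (i != j) && ~~ G i j].

Lemma compl_rel_sym G : ssrbool.symmetric (compl_rel G).
Proof. by move=> i j; rewrite /compl_rel /= eq_sym adj_sym. Qed.

Lemma compl_rel_irr G : irreflexive (compl_rel G).
Proof. by move=> i; rewrite /compl_rel /= eqxx. Qed.

Definition complement G : sgraph := SGraph (compl_rel_sym G) (compl_rel_irr G).

(* [ordS] is the cyclic successor i |-> i + 1 mod m. *)
Definition induced_cycle G m (c : 'I_m -> 'I_n) :=
  injective c /\
  forall i j, G (c i) (c j) = (j == ordS i) || (i == ordS j).

Definition chordal G :=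
  forall m (c : 'I_m -> 'I_n), (3 < m)%N -> ~ induced_cycle G c.

Definition cochordal G := chordal (complement G).

End Graphs.

Section Ideals.
Variables (K : fieldType) (n : nat).
Local Notation S := {mpoly K[n]}.
Implicit Types (I J : S -> Prop) (fs : seq S) (u v : 'X_{1..n}).

Definition ideal_gen (A : S -> Prop) : S -> Prop := fun p =>
  exists2 s : seq (S * S),
    (forall x, x \in s -> A x.2) & p = \sum_(x <- s) x.1 * x.2.

Definition colon I (u : S) : S -> Prop := fun p => I (p * u).

Definition gen_by_variables I :=
  exists A : {set 'I_n}, forall p,
    I p <-> ideal_gen (fun q => exists2 i, i \in A & q = 'X_i) p.

(* For a monomial ideal I, the minimal monomial generators are the monomials
   of I that are minimal for divisibility. *)
Definition min_generator I u :=
  I 'X_[u] /\ forall v, I 'X_[v] -> (v <= u)%MM -> v = u.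

Definition linear_quotients I :=
  exists us : seq 'X_{1..n},
    [/\ uniq us,
        forall u, u \in us <-> min_generator I u
      & forall i, (0 < i < size us)%N ->
          gen_by_variables
            (colon (ideal_gen (fun q => exists2 v, v \in take i us & q = 'X_[v]))
                   'X_[nth 0%MM us i])].

Definition ideal_add I fs : S -> Prop :=
  ideal_gen (fun q => I q \/ q \in fs).

Definition max_ideal : S -> Prop :=
  ideal_gen (fun q => exists i : 'I_n, q = 'X_i).

(* Regular sequences on S/I, written in S: f_i is a nonzerodivisor modulo
   I + (f_0, ..., f_(i-1)), and S/(I + (f_0, ..., f_(r-1))) is nonzero. *)
Definition regular_sequence I fs :=
  (forall i, (i < size fs)%N -> forall p,
     ideal_add I (take i fs) (fs`_i * p) -> ideal_add I (take i fs) p) /\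
  ~ ideal_add I fs 1.

Definition regular_sequence_in_max I fs :=
  regular_sequence I fs /\ forall f, f \in fs -> max_ideal f.

Definition is_depth_quotient I (d : nat) :=
  (exists2 fs, regular_sequence_in_max I fs & size fs = d) /\
  (forall fs, regular_sequence_in_max I fs -> (size fs <= d)%N).

(* depth (S/I) for a proper ideal I contained in (x_1, ..., x_n). The maximum
   exists, since depth (S/I) <= dim S = n, so the default 0 is not used. *)
Definition depth_quotient I : nat :=
  classical_sets.xget 0%N (is_depth_quotient I).

Definition sqfree_power (G : sgraph n) (k : nat) : S -> Prop :=
  ideal_gen (fun q => exists2 M : {set {set 'I_n}},
    is_kmatching G k M & q = \prod_(f in M) \prod_(i in f) 'X_i).

Definition norm_depth (G : sgraph n) (k : nat) : int :=
  (depth_quotient (sqfree_power G k))%:Z - (2 * k%:Z - 1).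

End Ideals.

Arguments sqfree_power K {n} G k _.
Arguments norm_depth K {n} G k.

(* Main.v *)
Require Import Defs.
From mathcomp Require Import all_boot all_order all_algebra.
From mathcomp Require Import mpoly.
From mathcomp Require Import ring.
From mathcomp Require boolp classical_sets.

(** Write I for the k-th squarefree power of the edge ideal, d = 2k, and e_i for
    the i-th elementary symmetric polynomial in all the variables.  If no
    k-matching dominates G, then e_1, ..., e_d is a regular sequence on S/I, so
    depth(S/I) >= 2k and the normalized depth at k is positive.

    For a set F of vertices let P_F be the prime generated by the variables
    outside F.  On S/P_F = K[x_i : i in F], the sequence e_1, ..., e_|F| is
    regular, and every x_i with i in F is a nonzerodivisor modulo e_1, ..., e_r
    as long as r < |F| ([elsym_regular]): e_1, ..., e_(|F|-1) restrict to the
    elementary symmetric polynomials of F minus i, so x_i followed by them is a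
    regular sequence by induction, and homogeneous regular sequences can be
    permuted ([homog_nzd_swap]).

    Since e_1, ..., e_d is regular on S, its regularity on S/I follows from
    I ∩ (e_1, ..., e_i) = (e_1, ..., e_i) I for i <= d.  Let N be the set of
    supports of monomials of I and write h in the left-hand side as the sum of
    a_F x_F, F in N.  It suffices to show a_F in P_F + (e_1, ..., e_i) for the F
    of least size s, since x_F P_F only involves sets of size s + 1
    ([monideal_esum_step]).  Suppose that some U with more than i elements
    contains F, and that every member of N of size at least s inside U contains
    F.  Modulo P_U, h is then x_F g with g = a_F modulo P_F, and x_F can be
    cancelled modulo P_U + (e_1, ..., e_i) ([isolated_coef]).

    If |F| > i one takes U = F.  The only other case is i = d and F = V(M) for a
    k-matching M.  As M is not dominating, some vertex l outside F has no
    neighbour in F.  One takes U = F + l: a k-matching inside U cannot cover l,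
    hence covers exactly F ([matched_supersets_isolated]). *)

Set Implicit Arguments.
Unset Strict Implicit.
Unset Printing Implicit Defensive.

Import GRing.Theory.
Local Open Scope ring_scope.

(** * Ideals as predicates *)

Section Ideals.
Variables (K : fieldType) (n : nat).
Local Notation S := {mpoly K[n]}.
Implicit Types (I J L : S -> Prop) (p q x : S) (F T U : {set 'I_n}).

Definition is_ideal L :=
  [/\ L 0, forall p q, L p -> L q -> L (p + q) & forall p q, L q -> L (p * q)].

Definition ideal1 : S -> Prop := fun=> True.
Definition ideal0 : S -> Prop := fun p => p = 0.

Lemma ideal1_is_ideal : is_ideal ideal1. Proof. by []. Qed.

Lemma ideal0_is_ideal : is_ideal ideal0.
Proof.
rewrite /ideal0; split=> // [p q -> ->|p q ->]; first by rewrite addr0.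
exact: mulr0.
Qed.

Lemma idealM L p q : is_ideal L -> L q -> L (p * q).
Proof. by case=> _ _; apply. Qed.

Lemma idealN L p : is_ideal L -> L p -> L (- p).
Proof. by move=> iL Lp; rewrite -mulN1r; apply: idealM. Qed.

Lemma idealB L p q : is_ideal L -> L p -> L q -> L (p - q).
Proof.
by move=> iL Lp Lq; case: (iL) => _ LD _; apply: (LD) => //; apply: idealN.
Qed.

Lemma ideal_congr L p q : is_ideal L -> L (p - q) -> L q -> L p.
Proof. by case=> _ LD _ Lpq Lq; rewrite -(subrK q p); apply: LD. Qed.

Lemma ideal_sum L (T : Type) (s : seq T) (P : pred T) (f : T -> S) :
  is_ideal L -> (forall i, P i -> L (f i)) -> L (\sum_(i <- s | P i) f i).
Proof. by case=> L0 LD _ Lf; apply: (big_ind L). Qed.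

Lemma ideal_sum_seq L (T : eqType) (s : seq T) (f : T -> S) :
  is_ideal L -> (forall i, i \in s -> L (f i)) -> L (\sum_(i <- s) f i).
Proof. by move=> iL Lf; rewrite big_seq; apply: ideal_sum. Qed.

Lemma ideal_gen_is_ideal (A : S -> Prop) : is_ideal (ideal_gen A).
Proof.
split=> [|p q [s As ->] [t At ->]|p q [s As ->]].
- by exists [::]; rewrite ?big_nil.
- exists (s ++ t); last by rewrite big_cat.
  by move=> x; rewrite mem_cat => /orP[/As|/At].
- exists [seq (p * x.1, x.2) | x : S * S <- s]; last first.
    by rewrite big_map mulr_sumr; apply: eq_bigr => x _; rewrite mulrA.
  by move=> _ /mapP[x /As Ax ->].
Qed.

Lemma ideal_gen_min (A : S -> Prop) L :
  is_ideal L -> (forall q, A q -> L q) -> forall p, ideal_gen A p -> L p.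
Proof.
move=> iL AL _ [s As ->]; apply: ideal_sum_seq => // x /As /AL Lx.
by apply: (idealM _ iL).
Qed.

Lemma ideal_gen_in (A : S -> Prop) q : A q -> ideal_gen A q.
Proof.
move=> Aq; exists [:: (1, q)]; last by rewrite big_seq1 mul1r.
by move=> x; rewrite inE => /eqP ->.
Qed.

(** * Homogeneous ideals and permuting regular sequences *)

Definition nzd_mod L x := forall p, L (x * p) -> L p.

Lemma nzd_mod_prod L (T : finType) (A : {pred T}) (f : T -> S) :
  (forall i, i \in A -> nzd_mod L (f i)) -> nzd_mod L (\prod_(i in A) f i).
Proof.
move=> nz; apply: (big_ind (nzd_mod L)) => // [p|x y Lx Ly p].
  by rewrite mul1r.
by rewrite -mulrA => /Lx/Ly.
Qed.

Definition homog_ideal L := forall t p, L p -> L (pihomog mdeg t p).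

Lemma pihomogM d t x p : x \is d.-homog ->
  pihomog mdeg t (x * p) =
    if (d <= t)%N then x * pihomog mdeg (t - d) p else 0.
Proof.
move=> hx; rewrite {1}(pihomog_partitionE (leqnn (mmeasure mdeg p))).
set k := mmeasure _ _.
have hxs s : x * pihomog mdeg s p \is (d + s).-homog.
  by apply: dhomogM => //; apply: pihomogP.
rewrite mulr_sumr raddf_sum /=; case: leqP => [le_dt|lt_td]; last first.
  apply: big1 => s _; apply: (pihomog_ne0 _ (hxs s)).
  by rewrite gtn_eqF // (leq_trans lt_td) ?leq_addr.
have [lt_tk|le_kt] := ltnP (t - d) k.
  rewrite (bigD1 (Ordinal lt_tk)) //= big1 ?addr0.
    by rewrite pihomog_dE // -[X in X.-homog](subnKC le_dt).
  move=> s /negbTE ne_s; apply: (pihomog_ne0 _ (hxs s)).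
  move: ne_s; rewrite -[in X in _ -> _ != X](subnKC le_dt) eqn_add2l -val_eqE /=.
  by move=> ->.
rewrite big1 => [|s _]; last first.
  apply: (pihomog_ne0 _ (hxs s)); rewrite -[X in _ != X](subnKC le_dt) eqn_add2l.
  by rewrite ltn_eqF // (leq_trans (ltn_ord s)).
rewrite pihomogE big_seq_cond big1 ?mulr0 // => m /andP[m_p /eqP dm].
by have := msize_mdeg_lt m_p; rewrite dm ltnNge le_kt.
Qed.

(** If x, g is a regular sequence on S/L, then g is already a nonzerodivisor on
    S/L.  A homogeneous p with g p in L lies in L + (x), so p = x p' modulo L
    with p' of smaller degree and, x being a nonzerodivisor, g p' in L.  The
    ideal L' plays the part of L + (x). *)
Lemma homog_nzd_descent d L L' x g : is_ideal L -> homog_ideal L ->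
  x \is 1.-homog -> g \is d.-homog ->
  (forall p, L p -> L' p) -> (forall p, L' p -> exists q, L (p - x * q)) ->
  nzd_mod L x -> nzd_mod L' g -> nzd_mod L g.
Proof.
move=> iL hL hx hg LL' L'L nx ng p Lgp.
have comp t : L (pihomog mdeg t p).
  have: L (g * pihomog mdeg t p).
    by have := hL (d + t)%N _ Lgp; rewrite (pihomogM _ _ hg) leq_addr addKn.
  have: pihomog mdeg t p \is t.-homog by apply: pihomogP.
  move: (pihomog _ _ _) => {Lgp}p; elim: t p => [|t IHt] p hp Lgp.
    have [q /(hL 0%N)] := L'L p (ng p (LL' _ Lgp)).
    by rewrite raddfB /= (pihomogM _ _ hx) subr0 pihomog_dE.
  have [q /(hL t.+1)] := L'L p (ng p (LL' _ Lgp)).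
  rewrite raddfB /= (pihomogM _ _ hx) subSS subn0 pihomog_dE //= => Lpq.
  apply: (ideal_congr iL Lpq); apply: idealM => //.
  apply: IHt; first exact: pihomogP.
  apply: nx; rewrite mulrCA; set y := x * _.
  have -> : g * y = g * p - g * (p - y) by ring.
  by apply: idealB => //; apply: idealM.
rewrite (pihomog_partitionE (leqnn (mmeasure mdeg p))).
by apply: ideal_sum.
Qed.

(** The sum L + (f_0, ..., f_(r-1)) I.  Taking the whole ring for I gives the
    ideals by which a regular sequence is tested, and taking a zero L gives the
    product (f_0, ..., f_(r-1)) I. *)
Fixpoint add_multiples (f : nat -> S) I L r : S -> Prop :=
  if r is r'.+1 then
    fun p => exists2 q, I q & add_multiples f I L r' (p - f r' * q)
  else L.

Section AddMultiples.
Variable f : nat -> S.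

Lemma add_multiples_ideal I L r : is_ideal I -> is_ideal L ->
  is_ideal (add_multiples f I L r).
Proof.
move=> iI iL; case: (iI) => I0 ID IM; elim: r => //= r [A0 AD AM]; split.
- by exists 0; rewrite ?mulr0 ?subr0.
- move=> p q [p' Ip Ap] [q' Iq Aq]; exists (p' + q'); first exact: ID.
  by rewrite mulrDr opprD addrACA; apply: AD.
- move=> p q [q' Iq Aq]; exists (p * q'); first exact: IM.
  by rewrite mulrCA -mulrBr; apply: AM.
Qed.

Lemma add_multiples_mul I L I' L' r x p :
  (forall q, I q -> I' (x * q)) -> (forall q, L q -> L' (x * q)) ->
  add_multiples f I L r p -> add_multiples f I' L' r (x * p).
Proof.
move=> II LL; elim: r p => [|r IHr] p /=; first exact: LL.
case=> q Iq /IHr Ap; exists (x * q); first exact: II.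
by rewrite mulrCA -mulrBr.
Qed.

Lemma add_multiplesS I L I' L' r p :
  (forall q, I q -> I' q) -> (forall q, L q -> L' q) ->
  add_multiples f I L r p -> add_multiples f I' L' r p.
Proof.
move=> II LL; rewrite -{2}(mul1r p).
by apply: add_multiples_mul => q; rewrite mul1r; [apply: II|apply: LL].
Qed.

Lemma add_multiples_base I L r p : is_ideal I ->
  L p -> add_multiples f I L r p.
Proof.
case=> I0 _ _; elim: r p => //= r IHr p Lp; exists 0 => //.
by rewrite mulr0 subr0; apply: IHr.
Qed.

Lemma add_multiples_gen L i r : is_ideal L -> (i < r)%N ->
  add_multiples f ideal1 L r (f i).
Proof.
move=> iL; elim: r => //= r IHr; rewrite ltnS leq_eqVlt => /predU1P[->|/IHr Af].
  exists 1 => //; rewrite mulr1 subrr.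
  by case: (add_multiples_ideal r ideal1_is_ideal iL).
by exists 0; rewrite ?mulr0 ?subr0.
Qed.

Lemma add_multiples_min L J r p : is_ideal J -> (forall q, L q -> J q) ->
  (forall i, (i < r)%N -> J (f i)) -> add_multiples f ideal1 L r p -> J p.
Proof.
move=> iJ LJ; elim: r p => [|r IHr] p /= Jf; first exact: LJ.
case=> q _ /IHr Jpq; rewrite -(subrK (f r * q) p); case: (iJ) => _ JD JM.
apply: (JD); first by apply: Jpq => i lt_ir; apply/Jf/leqW.
by rewrite mulrC; apply/JM/Jf.
Qed.

Lemma add_multiples_split I L r p : add_multiples f I L r p ->
  exists2 q, L q & add_multiples f I ideal0 r (p - q).
Proof.
elim: r p => [|r IHr] p /=; first by exists p => //; rewrite /ideal0 subrr.
case=> q Iq /IHr[l Ll Apq]; exists l => //; exists q => //.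
by rewrite addrAC.
Qed.

Lemma add_multiples_homog (d : nat -> nat) L r :
  (forall i, f i \is (d i).-homog) -> homog_ideal L ->
  homog_ideal (add_multiples f ideal1 L r).
Proof.
move=> hf hL; elim: r => //= r IHr t p [q _ /(IHr t)].
rewrite raddfB /= (pihomogM _ _ (hf r)); case: ifP => _ Ap.
  by exists (pihomog mdeg (t - d r) q).
by exists 0; rewrite ?mulr0.
Qed.

(** Permutability of homogeneous regular sequences, in the case needed: if
    x, f_0, ..., f_(r-1) is regular on S/L, then so is f_0, ..., f_(r-1), x.
    [homog_nzd_descent] removes x from in front of f_r.  Then x passes over
    f_r: computing modulo f_0, ..., f_(r-1), if x p = f_r q then q = x q', as
    f_r is regular modulo x, and x (p - f_r q') = 0 gives p = f_r q'.
    As before, L' plays the part of L + (x). *)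
Lemma homog_nzd_swap (d : nat -> nat) L L' x r : is_ideal L -> is_ideal L' ->
  homog_ideal L -> (forall i, f i \is (d i).-homog) -> x \is 1.-homog ->
  (forall p, L p -> L' p) -> (forall p, L' (x * p)) ->
  (forall p, L' p -> exists q, L (p - x * q)) ->
  nzd_mod L x ->
  (forall i, (i < r)%N -> nzd_mod (add_multiples f ideal1 L' i) (f i)) ->
  nzd_mod (add_multiples f ideal1 L r) x /\
  (forall i, (i < r)%N -> nzd_mod (add_multiples f ideal1 L i) (f i)).
Proof.
move=> iL iL' hL hf hx LL' L'x L'L nx.
have lift i p : add_multiples f ideal1 L' i p ->
    exists q, add_multiples f ideal1 L i (p - x * q).
  elim: i p => [|i IHi] p //=; first exact: L'L.
  by case=> q _ /IHi[q' Apq]; exists q'; exists q => //; rewrite addrAC.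
have mono i p : add_multiples f ideal1 L i p -> add_multiples f ideal1 L' i p.
  by apply: add_multiplesS.
elim: r => [|r IHr] nf; first by [].
have [i lt_ir|nxr nfr] := IHr; first by apply: nf; apply: leqW.
have iA := add_multiples_ideal r ideal1_is_ideal iL.
have iA' := add_multiples_ideal r ideal1_is_ideal iL'.
split=> [p /= [q _ Apq]|i].
  have /(nf r (ltnSn r))/lift[q' Aqq'] : add_multiples f ideal1 L' r (f r * q).
    have -> : f r * q = x * p - (x * p - f r * q) by ring.
    apply: idealB => //; last exact: mono.
    by apply: add_multiples_base.
  exists q' => //; apply: nxr.
  have -> : x * (p - f r * q') = (x * p - f r * q) + f r * (q - x * q') by ring.
  by case: iA => _ AD AM; apply: AD => //; apply: AM.
rewrite ltnS leq_eqVlt => /predU1P[->|/nfr //].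
apply: (homog_nzd_descent iA _ hx (hf r) (mono r) (lift r) nxr (nf r _)) => //.
exact: add_multiples_homog hf hL.
Qed.

End AddMultiples.

(** * Coordinate subspaces *)

(** The prime P_F generated by the variables outside F.  The description by
    coefficients makes it plain that the variables in F are nonzerodivisors
    modulo P_F; [vanishes_on_min] recovers the description by generators. *)
Definition vanishes_on F : S -> Prop := fun p =>
  forall m : 'X_{1..n}, (forall i, i \notin F -> m i = 0%N) -> p@_m = 0.

Lemma vanishes_on_is_ideal F : is_ideal (vanishes_on F).
Proof.
split=> [m _|p q Vp Vq m mF|p q Vq m mF]; first exact: mcoeff0.
  by rewrite mcoeffD Vp ?Vq ?addr0.
rewrite mcoeffM big1 // => -[k1 k2] /= /eqP def_m; rewrite Vq ?mulr0 // => i iF.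
have := congr1 (fun k : 'X_{1..n} => k i) def_m; rewrite /= mnmDE mF //.
by move/esym/eqP; rewrite addn_eq0 => /andP[_ /eqP].
Qed.

Lemma vanishes_on_homog F : homog_ideal (vanishes_on F).
Proof.
move=> t p Vp m mF; rewrite pihomogE raddf_sum big1_seq //= => k /andP[_ _].
rewrite mcoeffZ mcoeffX; case: eqP => [->|_]; last by rewrite mulr0.
by rewrite Vp ?mul0r.
Qed.

Lemma vanishes_onS F U p : F \subset U -> vanishes_on U p -> vanishes_on F p.
Proof.
move=> sFU Vp m mF; apply: Vp => i iU; apply: mF; apply: contra iU.
exact: (subsetP sFU).
Qed.

Lemma vanishes_onT p : vanishes_on setT p -> p = 0.
Proof.
by move=> Vp; apply/mpolyP=> m; rewrite mcoeff0 Vp // => i; rewrite inE.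
Qed.

Lemma vanishes_onX F i : i \notin F -> vanishes_on F 'X_i.
Proof.
move=> iF m mF; rewrite mcoeffX; case: eqP => // def_m.
by have := mF i iF; rewrite -def_m mnm1E eqxx.
Qed.

Lemma vanishes_on_min F L p : is_ideal L -> (forall i, i \notin F -> L 'X_i) ->
  vanishes_on F p -> L p.
Proof.
move=> iL LX Vp; rewrite (mpolyE p).
apply: ideal_sum_seq => // m m_p; rewrite -mul_mpolyC; apply: idealM => //.
have [|none] := boolP [exists i, (i \notin F) && (m i != 0%N)]; last first.
  case/negP: (m_p); rewrite mcoeff_msupp Vp ?eqxx // => i iF.
  by move/existsPn/(_ i): none; rewrite iF negbK => /eqP.
case/existsP=> i /andP[iF mi]; have le_im : (U_(i) <= m)%MM.
  apply/mnm_lepP=> j; rewrite mnm1E; case: eqP => // <-.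
  by rewrite lt0n.
by rewrite -(submK le_im) mpolyXD; apply: idealM => //; apply: LX.
Qed.

Lemma nzd_vanishes_onX F i : i \in F -> nzd_mod (vanishes_on F) 'X_i.
Proof.
move=> iF p Vp m mF; rewrite -(mcoeffMX p U_(i) m) mulrC Vp // => j jF.
rewrite mnmDE mF // addn0 mnm1E; case: eqP => // def_j.
by rewrite -def_j iF in jF.
Qed.

(** * Elementary symmetric polynomials on coordinate subspaces *)

Definition setmon T : S := \prod_(i in T) 'X_i.

Lemma setmonD T U : T \subset U -> setmon U = setmon T * setmon (U :\: T).
Proof. by move=> sTU; rewrite /setmon (big_setID T) /= (setIidPr sTU). Qed.

Lemma setmon_vanishes F T : ~~ (T \subset F) -> vanishes_on F (setmon T).
Proof.
case/subsetPn=> i iT iF; rewrite /setmon (bigD1 i) //= mulrC.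
by apply: (idealM _ (vanishes_on_is_ideal F)); apply: vanishes_onX.
Qed.

(** The index is shifted, so that the sequence starts with e_1. *)
Definition elsym i : S := mesym n K i.+1.

Lemma elsym_homog i : elsym i \is (i.+1).-homog.
Proof. exact: dhomog_mesym. Qed.

(** All the other squarefree monomials of degree |F| leave F. *)
Lemma elsym_setmon F : (0 < #|F|)%N -> vanishes_on F (elsym #|F|.-1 - setmon F).
Proof.
move=> F_gt0; rewrite /elsym prednK // /mesym (bigD1 F) //= -/(setmon F).
rewrite [X in X - _]addrC addrK.
apply: ideal_sum; first exact: vanishes_on_is_ideal.
move=> T /andP[/eqP cT neTF]; apply: setmon_vanishes.
by apply: contra neTF => sTF; rewrite eqEcard sTF cT leqnn.
Qed.

Definition esum L r := add_multiples elsym ideal1 L r.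

Lemma esum_vanishes_is_ideal F r : is_ideal (esum (vanishes_on F) r).
Proof.
apply: add_multiples_ideal; first exact: ideal1_is_ideal.
exact: vanishes_on_is_ideal.
Qed.

(** By induction on |F|: for i in F, the sequence x_i, e_1, ..., e_(|F|-1) is
    regular modulo P_F, because adding x_i to P_F gives the prime of F minus i.
    Permuting it proves everything except the last e_|F|, which is the product
    of the variables in F modulo P_F. *)
Lemma elsym_regular F :
  (forall r i, (r < #|F|)%N -> i \in F -> nzd_mod (esum (vanishes_on F) r) 'X_i) /\
  (forall r, (r < #|F|)%N -> nzd_mod (esum (vanishes_on F) r) (elsym r)).
Proof.
move: {2}#|F| (leqnn #|F|) => m; elim: m F => [|m IHm] F leFm.
  by split=> r; rewrite ltnNge (leq_trans leFm).
have step i : i \in F -> forall r, (r < #|F|)%N ->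
    nzd_mod (esum (vanishes_on F) r) 'X_i /\
    (forall j, (j < r)%N -> nzd_mod (esum (vanishes_on F) j) (elsym j)).
  move=> iF r; rewrite (cardsD1 i) iF ltnS => le_rF.
  have [|_ IHE] := IHm (F :\ i); first by move: leFm; rewrite (cardsD1 i) iF.
  have iV := vanishes_on_is_ideal.
  apply: (homog_nzd_swap (L' := vanishes_on (F :\ i)) (iV F) (iV _) _ elsym_homog).
  - exact: vanishes_on_homog.
  - by rewrite dhomogX; apply/eqP/mdeg1.
  - by move=> p; apply: vanishes_onS; apply: subD1set.
  - move=> p; rewrite mulrC; apply: (idealM _ (iV (F :\ i))).
    by apply: vanishes_onX; rewrite !inE eqxx.
  (* P_(F - i) = P_F + (x_i) *)
  - have iL : is_ideal (fun p => exists q, vanishes_on F (p - 'X_i * q)).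
      have [V0 VD VM] := iV F; split.
      + by exists 0; rewrite mulr0 subr0.
      + by move=> p q [p' Vp] [q' Vq]; exists (p' + q');
          rewrite mulrDr opprD addrACA; apply: VD.
      + by move=> p q [q' Vq]; exists (p * q'); rewrite mulrCA -mulrBr; apply: VM.
    move=> p; apply: (vanishes_on_min iL) => j; rewrite !inE negb_and negbK.
    case/predU1P=> [->|jF]; first by exists 1; rewrite mulr1 subrr; case: (iV F).
    by exists 0; rewrite mulr0 subr0; apply: vanishes_onX.
  - exact: nzd_vanishes_onX.
  - by move=> j lt_jr; apply: IHE; apply: leq_trans lt_jr le_rF.
have X r i : (r < #|F|)%N -> i \in F -> nzd_mod (esum (vanishes_on F) r) 'X_i.
  by move=> lt_rF /step/(_ r lt_rF)[].
split=> // r lt_rF.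
have /card_gt0P[i iF] : (0 < #|F|)%N by apply: leq_ltn_trans lt_rF.
have [lt_r1F|le_Fr1] := ltnP r.+1 #|F|.
  by have [_] := step i iF _ lt_r1F; apply.
have def_r : r = #|F|.-1.
  by have/eqP-> : #|F| == r.+1 by rewrite eqn_leq le_Fr1.
have iE := esum_vanishes_is_ideal F r.
move=> p Ep; apply: (@nzd_mod_prod _ _ (mem F) (fun i => 'X_i)) => [j jF|].
  exact: X.
rewrite -/(setmon F).
have -> : setmon F * p = elsym r * p - (elsym r - setmon F) * p by ring.
apply: idealB => //; rewrite mulrC; apply: (idealM _ iE).
apply: add_multiples_base => //; rewrite def_r; apply: elsym_setmon.
exact: leq_ltn_trans lt_rF.
Qed.

End Ideals.

(** * Squarefree monomial ideals and elementary symmetric polynomials *)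

Section MonomialIdeals.
Variables (K : fieldType) (n : nat).
Local Notation S := {mpoly K[n]}.
Implicit Types (p q h : S) (N : {set {set 'I_n}}) (F T U : {set 'I_n}).

Definition monideal N : S -> Prop := fun p =>
  exists a : {set 'I_n} -> S, p = \sum_(T in N) a T * setmon K T.

Definition of_size_ge N s := [set T in N | (s <= #|T|)%N].

Lemma monideal_is_ideal N : is_ideal (monideal N).
Proof.
split=> [|p q [a ->] [b ->]|p q [a ->]].
- by exists (fun=> 0); rewrite big1 // => T _; rewrite mul0r.
- exists (fun T => a T + b T); rewrite -big_split.
  by apply: eq_bigr => T _; rewrite mulrDl.
- exists (fun T => p * a T); rewrite mulr_sumr.
  by apply: eq_bigr => T _; rewrite mulrA.
Qed.

Lemma monideal_setmon N T : T \in N -> monideal N (setmon K T).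
Proof.
move=> TN; exists (fun U => (U == T)%:R); rewrite (bigD1 T) //= eqxx mul1r.
by rewrite big1 ?addr0 // => U /andP[_ /negbTE->]; rewrite mul0r.
Qed.

Lemma monideal_gen_min N L : is_ideal L ->
  (forall T, T \in N -> L (setmon K T)) -> forall p, monideal N p -> L p.
Proof.
move=> iL NL _ [a ->]; apply: ideal_sum => // T /NL LT.
by apply: (idealM _ iL).
Qed.

Lemma monideal_of_sizeS N s p : monideal (of_size_ge N s) p -> monideal N p.
Proof.
apply: monideal_gen_min => [|T]; first exact: monideal_is_ideal.
by rewrite inE => /andP[TN _]; apply: monideal_setmon.
Qed.

Definition up_closed N := forall T U, T \in N -> T \subset U -> U \in N.

(** On the coordinate subspace of U, which is large enough for the variables to
    be nonzerodivisors modulo e_1, ..., e_i, the ideal of N becomes a multiple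
    of x_F. *)
Definition isolates N i F U :=
  [/\ F \subset U, (i < #|U|)%N & forall T, T \in N -> T \subset U -> F \subset T].

(** Modulo P_U only the terms with T inside U survive, and they share the factor
    x_F, which can be cancelled because i < |U|.  The cofactor g reduces to a_F
    modulo P_F, since x_(T - F) lies in P_F as soon as T is larger than F. *)
Lemma isolated_coef N i F U (a : {set 'I_n} -> S) :
  F \in N -> isolates N i F U ->
  esum (vanishes_on U) i (\sum_(T in N) a T * setmon K T) ->
  esum (vanishes_on F) i (a F).
Proof.
move=> FN [sFU lt_iU min_F] Eh.
have iU := esum_vanishes_is_ideal K U i; have iF := esum_vanishes_is_ideal K F i.
pose g := \sum_(T in N | T \subset U) a T * setmon K (T :\: F).
have Eg : esum (vanishes_on U) i g.
  apply: (@nzd_mod_prod _ _ _ _ (mem F) (fun j => 'X_j)) => [j jF|].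
    by have [X _] := elsym_regular K U; apply: X; rewrite // (subsetP sFU).
  apply: (ideal_congr iU _ Eh); rewrite -/(setmon K F) -opprB.
  apply/(idealN iU)/add_multiples_base=> //.
  rewrite (bigID (fun T => T \subset U)) /= mulr_sumr addrAC.
  have -> : \sum_(T in N | T \subset U) a T * setmon K T =
            \sum_(T in N | T \subset U) setmon K F * (a T * setmon K (T :\: F)).
    apply: eq_bigr => T /andP[TN sTU].
    by rewrite (setmonD K (min_F T TN sTU)) mulrCA.
  rewrite subrr add0r; apply: ideal_sum => [|T /andP[_ nsTU]].
    exact: vanishes_on_is_ideal.
  apply: (idealM _ (vanishes_on_is_ideal K U)).
  exact: setmon_vanishes.
apply: (ideal_congr iF (q := g)); last first.
  by apply: add_multiplesS Eg => // q; apply: vanishes_onS.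
rewrite -opprB; apply/(idealN iF)/add_multiples_base=> //.
rewrite /g (bigD1 F) /=; last by rewrite FN.
rewrite setDv /setmon big_set0 mulr1 addrAC subrr add0r.
apply: ideal_sum => [|T /andP[/andP[TN sTU] neTF]]; first exact: vanishes_on_is_ideal.
apply: (idealM _ (vanishes_on_is_ideal K F)).
apply: setmon_vanishes; apply/negP=> /subsetP sTDF; case/negP: neTF.
rewrite eqEsubset min_F // andbT; apply/subsetP=> j jT; apply/negPn/negP=> jF.
by have := sTDF j; rewrite !inE jF jT => /(_ isT); apply/negP.
Qed.

(** One step towards I ∩ (e_1, ..., e_i) = (e_1, ..., e_i) I: in each term
    a_F x_F with |F| = s, [isolated_coef] replaces a_F by an element of
    (e_1, ..., e_i) plus one of P_F, and x_F x_j has a support of size s + 1 for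
    j outside F. *)
Lemma monideal_esum_step N s i h : up_closed N ->
  (forall F, F \in N -> #|F| = s -> exists U, isolates (of_size_ge N s) i F U) ->
  monideal (of_size_ge N s) h -> esum (@ideal0 K n) i h ->
  add_multiples (@elsym K n) (monideal (of_size_ge N s))
    (monideal (of_size_ge N s.+1)) i h.
Proof.
move=> upN iso [a def_h] Eh.
have iM := monideal_is_ideal.
have iA := add_multiples_ideal (@elsym K n) i (iM (of_size_ge N s))
  (iM (of_size_ge N s.+1)).
rewrite def_h; apply: ideal_sum => // F Fs.
have [FN] : F \in N /\ (s <= #|F|)%N by move: Fs; rewrite inE => /andP.
rewrite leq_eqVlt => /predU1P[/esym cF|lt_sF]; last first.
  apply: add_multiples_base => //; apply: (idealM _ (iM (of_size_ge N s.+1))).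
  by apply: monideal_setmon; rewrite inE FN.
have [U isoU] := iso F FN cF.
have Ea : esum (vanishes_on F) i (a F).
  apply: (isolated_coef Fs isoU); rewrite -def_h.
  by apply: add_multiplesS Eh => // q ->; case: (vanishes_on_is_ideal K U).
rewrite mulrC; apply: add_multiples_mul Ea => q.
  move=> _; rewrite mulrC; apply: (idealM _ (iM (of_size_ge N s))).
  exact: monideal_setmon.
pose L q := monideal (of_size_ge N s.+1) (setmon K F * q).
apply: (vanishes_on_min (L := L)) => [|j jF]; rewrite {}/L.
  case: (iM (of_size_ge N s.+1)) => M0 MD MM; split.
  - by rewrite mulr0.
  - by move=> p r Mp Mr; rewrite mulrDr; apply: MD.
  - by move=> p r Mr; rewrite mulrCA; apply: MM.
have -> : setmon K F * 'X_j = setmon K (j |: F).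
  by rewrite /setmon big_setU1 //= mulrC.
apply: monideal_setmon; rewrite inE cardsU1 jF cF leqnn andbT.
by apply: upN FN _; apply: subsetUr.
Qed.

(** The step is iterated until s exceeds the number of variables.  The error
    term stays in (e_1, ..., e_i), since what is subtracted lies there. *)
Lemma monideal_esum N i s h : up_closed N ->
  (forall F, F \in N -> (s <= #|F|)%N ->
     exists U, isolates (of_size_ge N #|F|) i F U) ->
  monideal (of_size_ge N s) h -> esum (@ideal0 K n) i h ->
  add_multiples (@elsym K n) (monideal N) (@ideal0 K n) i h.
Proof.
move=> upN.
have i0 := ideal0_is_ideal K n.
have iA := add_multiples_ideal (@elsym K n) i (monideal_is_ideal N) i0.
have iE := add_multiples_ideal (@elsym K n) i (ideal1_is_ideal K n) i0.
have [t] := ubnP (n.+1 - s); elim: t s h => // t IHt s h le_t iso Mh Eh.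
have [lt_ns|le_sn] := ltnP n s.
  have -> : h = 0.
    case: Mh => a ->; apply: big1 => T; rewrite inE => /andP[_ le_sT].
    by have := leq_trans lt_ns (leq_trans le_sT (max_card _)); rewrite card_ord ltnn.
  by case: iA.
have iso_s F : F \in N -> #|F| = s ->
    exists U, isolates (of_size_ge N s) i F U.
  by move=> FN cF; rewrite -cF; apply: iso; rewrite // cF.
have [q Mq Ehq] := add_multiples_split (monideal_esum_step upN iso_s Mh Eh).
have Ahq : add_multiples (@elsym K n) (monideal N) (@ideal0 K n) i (h - q).
  by apply: add_multiplesS Ehq => // p; apply: monideal_of_sizeS.
apply: (ideal_congr iA Ahq); apply: (IHt s.+1) => //.
- by rewrite subSS; move: le_t; rewrite subSn.
- by move=> F FN /ltnW; apply: iso.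
have -> : q = h - (h - q) by ring.
by apply: idealB => //; apply: add_multiplesS Ahq.
Qed.

(** If e_(i+1) p = h modulo e_1, ..., e_i with h in the monomial ideal, then
    [monideal_esum] writes h with coefficients in that ideal; with c the one of
    e_(i+1), the regularity of e_1, ..., e_n on S cancels e_(i+1) from
    e_(i+1) (p - c). *)
Lemma monideal_regular N d : up_closed N -> (d <= n)%N ->
  (forall F i, F \in N -> (i <= d)%N ->
     exists U, isolates (of_size_ge N #|F|) i F U) ->
  forall i, (i < d)%N -> nzd_mod (esum (monideal N) i) (@elsym K n i).
Proof.
move=> upN le_dn iso i lt_id p Ep.
have iE := add_multiples_ideal (@elsym K n) i (ideal1_is_ideal K n)
  (ideal0_is_ideal K n).
have [h Mh E0] := add_multiples_split Ep.
have Eh : esum (@ideal0 K n) i.+1 h.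
  by exists p => //; rewrite -opprB; apply: idealN.
have Mh0 : monideal (of_size_ge N 0) h.
  apply: monideal_gen_min Mh => [|T TN]; first exact: monideal_is_ideal.
  by apply: monideal_setmon; rewrite inE TN.
have [c Mc Ac] := monideal_esum upN (fun F FN _ => iso F i.+1 FN lt_id) Mh0 Eh.
have [_ /(_ i)] := elsym_regular K [set: 'I_n]; rewrite cardsT card_ord.
move=> /(_ (leq_trans lt_id le_dn) (p - c)) nz.
have: esum (monideal N) i (p - c).
  apply: add_multiplesS (nz _) => // [q /vanishes_onT ->|].
    by case: (monideal_is_ideal N).
  have : esum (@ideal0 K n) i (@elsym K n i * (p - c)).
    have -> : @elsym K n i * (p - c) =
              (@elsym K n i * p - h) + (h - @elsym K n i * c) by ring.
    case: iE => _ ED _; apply: ED => //.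
    exact: add_multiplesS Ac.
  by apply: add_multiplesS => // q ->; case: (vanishes_on_is_ideal K [set: 'I_n]).
move=> Epc; apply: ideal_congr Epc _.
  by apply: add_multiples_ideal; [apply: ideal1_is_ideal|apply: monideal_is_ideal].
by apply: add_multiples_base.
Qed.

End MonomialIdeals.

(** * Matchings *)

Section Matchings.
Variables (K : fieldType) (n : nat) (G : sgraph n) (k : nat).
Local Notation S := {mpoly K[n]}.

Lemma card_cover_matching M : is_matching G M -> #|cover M| = (2 * #|M|)%N.
Proof.
case/andP=> /subsetP ME /eqP <-; rewrite mulnC -sum_nat_const.
apply: eq_bigr => f /ME; rewrite inE => /existsP[i /existsP[j /andP[Gij /eqP ->]]].
by rewrite cards2; case: eqP Gij => // ->; rewrite adj_irr.
Qed.

Lemma cover_matching_adj M v : is_matching G M -> v \in cover M ->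
  exists2 u, u \in cover M & G v u.
Proof.
case/andP=> /subsetP ME _ /bigcupP[f fM]; have := ME f fM.
rewrite inE => /existsP[i /existsP[j /andP[Gij /eqP def_f]]] vf.
have in_cover u : u \in f -> u \in cover M by move=> uf; apply/bigcupP; exists f.
move: vf; rewrite def_f => /set2P[] ->.
  by exists j => //; apply: in_cover; rewrite def_f set22.
by exists i; [apply: in_cover; rewrite def_f set21|rewrite adj_sym].
Qed.

(** The supports of the monomials in the k-th squarefree power. *)
Definition matched_supersets : {set {set 'I_n}} :=
  [set T : {set 'I_n} | [exists M, is_kmatching G k M && (cover M \subset T)]].

Lemma matched_supersetsP (T : {set 'I_n}) :
  reflect (exists2 M, is_kmatching G k M & cover M \subset T)
          (T \in matched_supersets).
Proof.
rewrite inE; apply: (iffP existsP) => [[M /andP[]]|[M kM sM]]; exists M => //.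
by rewrite kM.
Qed.

Lemma kmatching_monomial M : is_kmatching G k M ->
  \prod_(f in M) \prod_(i in f) 'X_i = setmon K (cover M).
Proof. by case/andP=> /andP[_ tM] _; rewrite /setmon big_trivIset. Qed.

Lemma sqfree_power_monideal p :
  sqfree_power K G k p <-> monideal matched_supersets p.
Proof.
split.
  apply: ideal_gen_min => [|_ [M kM ->]]; first exact: monideal_is_ideal.
  rewrite kmatching_monomial //; apply: monideal_setmon.
  by apply/matched_supersetsP; exists M.
apply: monideal_gen_min => [|T /matched_supersetsP[M kM sMT]].
  exact: ideal_gen_is_ideal.
rewrite (setmonD K sMT) mulrC.
apply: idealM; first exact: ideal_gen_is_ideal.
by apply: ideal_gen_in; exists M; rewrite ?kmatching_monomial.
Qed.

Lemma matched_supersets_up : up_closed matched_supersets.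
Proof.
move=> T U /matched_supersetsP[M kM sMT] sTU; apply/matched_supersetsP.
by exists M => //; apply: subset_trans sTU.
Qed.

(** If |F| <= 2k then F is the vertex set of a k-matching M, and a vertex l
    witnessing that M is not dominating isolates F inside F + l: a k-matching
    covering l would use an edge from l to F. *)
Lemma matched_supersets_isolated :
  (forall M, ~ is_dominating_kmatching G k M) ->
  forall F i, F \in matched_supersets -> (i <= 2 * k)%N ->
  exists U, isolates (of_size_ge matched_supersets #|F|) i F U.
Proof.
move=> noDom F i /matched_supersetsP[M kM sMF] le_ik.
have card_cover M' : is_kmatching G k M' -> #|cover M'| = (2 * k)%N.
  by case/andP=> /card_cover_matching-> /eqP->.
have [lt_iF|le_Fi] := ltnP i #|F|.
  exists F; split=> // T; rewrite inE => /andP[_ le_FT] sTF.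
  by have/eqP-> : T == F by rewrite eqEcard sTF.
have def_F : cover M = F.
  apply/eqP; rewrite eqEcard sMF card_cover //.
  exact: leq_trans le_ik.
have [l lF nadj] : exists2 l, l \notin F & forall u, u \in F -> ~~ G l u.
  have [|none] := boolP [exists l, (l \notin F) && [forall u in F, ~~ G l u]].
    by case/existsP=> l /andP[lF /forall_inP nadj]; exists l.
  case: (noDom M); split=> // v; rewrite def_F => vF.
  move/existsPn/(_ v): none; rewrite vF /= => /forall_inPn[u uF].
  by rewrite negbK; exists u.
exists (l |: F); split; first exact: subsetUr.
  by rewrite cardsU1 lF ltnS (leq_trans le_ik) // -(card_cover M kM) def_F.
move=> T; rewrite inE => /andP[/matched_supersetsP[M' kM' sMT] _] sTU.
have sMU := subset_trans sMT sTU.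
have lM' : l \notin cover M'.
  apply/negP=> /(cover_matching_adj (andP kM').1)[u uM' Glu].
  have := subsetP sMU u uM'; rewrite !inE => /predU1P[def_u|/nadj].
    by rewrite def_u adj_irr in Glu.
  by rewrite Glu.
suff <- : cover M' = F by [].
apply/eqP; rewrite eqEcard card_cover // -def_F card_cover // leqnn andbT.
rewrite def_F; apply/subsetP=> u uM'; have := subsetP sMU u uM'.
by rewrite !inE => /predU1P[def_u|//]; rewrite -def_u uM' in lM'.
Qed.

Lemma max_ideal_elsym i : max_ideal (@elsym K n i).
Proof.
have iM : is_ideal (@max_ideal K n) by apply: ideal_gen_is_ideal.
apply: ideal_sum => // T /eqP cT.
have /card_gt0P[j jT] : (0 < #|T|)%N by rewrite cT.
rewrite (bigD1 j) //= mulrC; apply: (idealM _ iM).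
by apply: ideal_gen_in; exists j.
Qed.

Lemma max_ideal_proper : ~ @max_ideal K n 1.
Proof.
move=> m1; have : vanishes_on set0 (1 : S).
  apply: ideal_gen_min m1 => [|_ [i ->]]; first exact: vanishes_on_is_ideal.
  by apply: vanishes_onX; rewrite inE.
move/(_ 0%MM) => /(_ (fun i _ => mnm0E i)) /eqP.
by rewrite mcoeff1 eqxx oner_eq0.
Qed.

Definition elsyms d : seq S := [seq @elsym K n i | i <- iota 0 d].

Lemma ideal_add_elsyms (I L : S -> Prop) d p : is_ideal L ->
  (forall q, I q <-> L q) -> ideal_add I (elsyms d) p <-> esum L d p.
Proof.
move=> iL IL; split.
  apply: ideal_gen_min => [|q [/IL Lq|/mapP[i]]].
  - by apply: add_multiples_ideal => //; apply: ideal1_is_ideal.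
  - exact: add_multiples_base.
  - by rewrite mem_iota /= => lt_id ->; apply: add_multiples_gen.
apply: add_multiples_min => [|q /IL Iq|i lt_id].
- exact: ideal_gen_is_ideal.
- by apply: ideal_gen_in; left.
- by apply: ideal_gen_in; right; apply/map_f; rewrite mem_iota.
Qed.

(** * Depth of squarefree powers *)

Lemma sqfree_power_elsyms_regular : (0 < k)%N -> (2 * k <= n)%N ->
  (forall M, ~ is_dominating_kmatching G k M) ->
  regular_sequence_in_max (sqfree_power K G k) (elsyms (2 * k)).
Proof.
move=> k_gt0 le_kn noDom; set N := matched_supersets.
have iN := monideal_is_ideal K N.
have addE d p := ideal_add_elsyms d p iN sqfree_power_monideal.
have NE T : T \in N -> (0 < #|T|)%N.
  case/matched_supersetsP=> M /andP[/card_cover_matching cM /eqP def_k] /subset_leq_card.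
  by apply: leq_trans; rewrite cM def_k muln_gt0.
split; last by move=> _ /mapP[i _ ->]; apply: max_ideal_elsym.
split=> [i|/addE].
  rewrite size_map size_iota => lt_ik p.
  rewrite /elsyms (nth_map 0%N) ?size_iota // nth_iota // -map_take take_iota.
  rewrite (minn_idPl (ltnW lt_ik)) => /addE Ep; apply/addE.
  apply: (monideal_regular matched_supersets_up le_kn _ lt_ik Ep) => F j.
  exact: matched_supersets_isolated.
move=> E1; apply: max_ideal_proper.
apply: add_multiples_min E1 => [||i _]; first exact: ideal_gen_is_ideal.
  apply: monideal_gen_min => [|T /NE/card_gt0P[j jT]]; first exact: ideal_gen_is_ideal.
  rewrite /setmon (bigD1 j) //= mulrC.
  apply: idealM; first exact: ideal_gen_is_ideal.
  by apply: ideal_gen_in; exists j.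
exact: max_ideal_elsym.
Qed.

Lemma matching_number_double : (2 * matching_number G <= n)%N.
Proof.
have M0 : is_matching G set0.
  rewrite /is_matching sub0set; apply/trivIsetP=> A B; by rewrite inE.
rewrite /matching_number (bigmax_eq_arg set0) //.
case: arg_maxnP => // M mM _; rewrite -card_cover_matching //.
by rewrite -[X in (_ <= X)%N]card_ord max_card.
Qed.

(** Normalized depth 0 means depth 2k - 1, which is too small for a regular
    sequence of length 2k.  As 2k - 1 > 0, the depth is not the default value of
    [depth_quotient], so it does bound the lengths of regular sequences. *)
Lemma norm_depth0_dominating : (1 <= k <= matching_number G)%N ->
  norm_depth K G k = 0 -> exists M, is_dominating_kmatching G k M.
Proof.
case/andP=> k_gt0 le_k g0; apply: boolp.contrapT => noDom.
have depthE : depth_quotient (sqfree_power K G k) = (2 * k - 1)%N.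
  move/eqP: g0; rewrite /norm_depth subr_eq0 => /eqP g0.
  apply/eqP; rewrite -eqz_nat g0 -subzn ?muln_gt0 //.
move: depthE; rewrite /depth_quotient.
case: classical_sets.xgetP => [d -> [_ le_d] def_d|_ def_d].
  have reg := sqfree_power_elsyms_regular k_gt0
    (leq_trans (leq_mul (leqnn 2) le_k) matching_number_double)
    (fun M domM => noDom (ex_intro _ M domM)).
  have := le_d _ reg; rewrite size_map size_iota def_d.
  by rewrite subn1 leqNgt prednK ?leqnn // muln_gt0.
by have := leq_pmulr 2 k_gt0; rewrite -subn_gt0 -def_d.
Qed.

End Matchings.

Theorem corollary3p4 (K : fieldType) (n : nat) (G : sgraph n) (k : nat)
    (hG : no_isolated_vertex G) (hk : (1 <= k <= matching_number G)%N) :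
  (linear_quotients (sqfree_power K G k) ->
   norm_depth K G k = 0 ->
   exists M : {set {set 'I_n}}, is_dominating_kmatching G k M)
  /\
  (cochordal G ->
   norm_depth K G k = 0 ->
   exists M : {set {set 'I_n}}, is_dominating_kmatching G k M).
Proof.
by split=> _; apply: norm_depth0_dominating.
Qed.
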